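(* Let $X$ be a Hausdorff space and let $A\in\mathcal{S}(X)$. For any sequence $\{A_n\}_{n\in\mathbb{N}}$ in $\mathcal{S}(X)$, the following conditions (1)-(3) are equivalent: (1) The sequence $\{A_n\}$ converges to $A$ in $\mathcal{S}(X)$. (2) The sequence $\{A_n\}$ satisfies both of the following: (i) for any strictly increasing sequence $\{n_k\}_{k\in\mathbb{N}}\subset\mathbb{N}$ we have $A=\bigcap_{n=1}^{\infty}\overline{\bigcup_{k\geq n}A_{n_k}}$ (closures in $X$); (ii) for any neighborhood $U$ of $A$ in $X$ there is $N\in\mathbb{N}$ such that $A_n\subset U$ for any $n>N$. (3) The sequence $\{A_n\}$ satisfies both of the following: (i$'$) for any strictly increasing sequence $\{n_k\}_{k\in\mathbb{N}}\subset\mathbb{N}$ we have $A=\bigcap_{n=1}^{\infty}\overline{\bigcup_{k\geq n}A_{n_k}}$; (ii$'$) for any sequential neighborhood $U$ of $A$ in $X$ there is $N\in\mathbb{N}$ such that $A_n\subset U$ for any $n>N$.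
   Context: For a Hausdorff space $X$, $\mathcal{S}(X)$ is the set of all nonempty subsets of $X$ that are unions of finitely many convergent sequences of $X$, where a convergent sequence is understood as a set $\{x_j:j\in\mathbb{N}\}\cup\{x\}$ with $x_j\to x$ in $X$ (trivial, i.e. constant, sequences allowed). $\mathcal{S}(X)$ carries the Vietoris topology, whose basic open sets are $\langle U_1,\dots,U_r\rangle=\{S\in\mathcal{S}(X): S\subset\bigcup_{i=1}^r U_i \text{ and } S\cap U_j\neq\emptyset \text{ for } 1\le j\le r\}$ with $r\in\mathbb{N}$ and $U_1,\dots,U_r$ open in $X$. A subset $U$ of $X$ is a sequential neighborhood of a set $A\subset X$ if $A\subset U$ and each sequence of $X$ converging to some point $x\in A$ is eventually in $U$. *)

(* Defs.v *)
From HB Require Import structures.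
From mathcomp Require Import all_boot.
From mathcomp Require Import boolp classical_sets filter topology.

Set Implicit Arguments.
Unset Strict Implicit.
Unset Printing Implicit Defensive.

Local Open Scope classical_set_scope.

Definition convergent_sequence (X : topologicalType) : set (set X) :=
  [set C | exists (u : nat -> X) (x : X),
     u @ \oo --> x /\ C = range u `|` [set x]].

Definition finite_union_cvg_seq (X : topologicalType) : set (set X) :=
  [set A | A !=set0 /\
     exists (m : nat) (C : 'I_m -> set X),
       (forall i, convergent_sequence (C i)) /\ A = \bigcup_i C i].

Record hyperspace (X : topologicalType) := Hyperspace {
  hyperspace_set :> set X;
  hyperspace_setP : hyperspace_set \in @finite_union_cvg_seq X }.

HB.instance Definition _ (X : topologicalType) :=
  [isSub for @hyperspace_set X].
HB.instance Definition _ (X : topologicalType) :=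
  [Choice of hyperspace X by <:].

Definition vietoris_set (X : topologicalType) (r : nat) (U : 'I_r -> set X) :
    set (hyperspace X) :=
  [set S : hyperspace X |
     S `<=` \bigcup_i U i /\ forall j, S `&` U j !=set0].

(* The degenerate case r = 0 yields the empty set, since the points of the
   hyperspace are nonempty. *)
Definition vietoris_base (X : topologicalType) : set (set (hyperspace X)) :=
  [set W | exists (r : nat) (U : 'I_r -> set X),
     (forall i, open (U i)) /\ W = vietoris_set U].

Lemma vietoris_base_cover (X : topologicalType) :
  \bigcup_(W in @vietoris_base X) W = setT.
Proof.
apply/seteqP; split=> // S _.
exists (vietoris_set (fun _ : 'I_1 => setT)).
  by exists 1, (fun=> setT); split=> // _; exact: openT.
split=> [x _|_]; first by exists ord0.
by have /set_mem[[x Sx] _] := hyperspace_setP S; exists x.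
Qed.

Lemma vietoris_base_join (X : topologicalType)
    (W1 W2 : set (hyperspace X)) (S : hyperspace X) :
  vietoris_base W1 -> vietoris_base W2 -> W1 S -> W2 S ->
  exists W, [/\ vietoris_base W, W S & W `<=` W1 `&` W2].
Proof.
move=> [r [U [oU ->]]] [s [V [oV ->]]] [SU SUi] [SV SVj].
pose UV (k : 'I_(r + s)) := match split k with
  | inl i => U i `&` \bigcup_j V j
  | inr j => V j `&` \bigcup_i U i end.
have UVl i : UV (lshift s i) = U i `&` \bigcup_j V j.
  by rewrite /UV (unsplitK (inl i)).
have UVr j : UV (rshift r j) = V j `&` \bigcup_i U i.
  by rewrite /UV (unsplitK (inr j)).
have oUV k : open (UV k).
  rewrite /UV; case: split => i; apply: openI => //;
    by apply: bigcup_open => ? _.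
exists (vietoris_set UV); split; first by exists (r + s)%N, UV.
  split=> [x Sx|k].
    have [i _ Uix] := SU _ Sx; exists (lshift s i) => //.
    by rewrite UVl; split=> //; exact: SV.
  rewrite /UV; case: split => i.
    by have [x [Sx Ux]] := SUi i; exists x; split=> //; split=> //; exact: SV.
  by have [x [Sx Vx]] := SVj i; exists x; split=> //; split=> //; exact: SU.
move=> T [TUV TUVk]; split; split.
- move=> x /TUV[k _]; rewrite /UV; case: split => i [] //.
  by move=> Uix _; exists i.
- move=> i; have [x []] := TUVk (lshift s i).
  by rewrite UVl => Tx [Ux _]; exists x.
- move=> x /TUV[k _]; rewrite /UV; case: split => i [] //.
  by move=> Vix _; exists i.
- move=> j; have [x []] := TUVk (rshift r j).
  by rewrite UVr => Tx [Vx _]; exists x.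
Qed.

HB.instance Definition _ (X : topologicalType) :=
  isBaseTopological.Build (hyperspace X)
    (@vietoris_base_cover X) (@vietoris_base_join X).

Lemma nbhs_hyperspaceE (X : topologicalType) (S : hyperspace X)
    (W : set (hyperspace X)) :
  nbhs S W <-> exists2 B, vietoris_base B & B S /\ B `<=` W.
Proof.
split=> [[_ [[D DB <-] [B DB' BS] BW]]|[B bB [BS BW]]].
  by exists B; [exact: DB|split=> // T BT; apply: BW; exists B].
exists B; split=> //; exists [set B]; last by rewrite bigcup_set1.
by move=> _ ->.
Qed.

Definition sequential_nbhd (X : topologicalType) (A U : set X) : Prop :=
  A `<=` U /\
  forall (u : nat -> X) (x : X), A x -> u @ \oo --> x ->
    \forall n \near \oo, U (u n).

Definition strictly_increasing (f : nat -> nat) : Prop :=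
  {homo f : i j / (i < j)%N}.

Definition subsequence_limsup_eq (X : topologicalType)
    (A : set X) (A_ : nat -> set X) : Prop :=
  forall nk : nat -> nat, strictly_increasing nk ->
    A = \bigcap_n closure (\bigcup_(k in [set k | (n <= k)%N]) A_ (nk k)).

(* Main.v *)
Require Import Defs.
From mathcomp Require Import all_boot.
From mathcomp Require Import boolp classical_sets functions cardinality filter.
From mathcomp Require Import topology.

(** A member of the hyperspace is a compact countable set, and these two
    properties are all that the equivalences use about it.

    A basic Vietoris neighborhood of [A] imposes an upper condition (stay inside
    an open set containing [A]) and finitely many lower conditions (meet an open
    set that meets [A]). Convergence therefore says that [A_ n] is eventually
    inside every neighborhood of [A] and eventually meets every neighborhood of
    every point of [A]. The first half is (ii). Given (ii), the second half is
    (i): if [A_ n] missed an open set [U] for infinitely many [n], the limsup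
    along these [n] would miss [U] as well; conversely the lower conditions put
    [A] inside the limsup of every subsequence, and the upper ones put this
    limsup inside [A], because a point outside the compact set [A] can be
    separated from it by open sets ([compact_point_separation]).

    A neighborhood is a sequential neighborhood, so (ii') implies (ii). The
    converse rests on [countable_compact_cvg_subsequence]: a sequence of points
    that is eventually in every neighborhood of a countable compact set [A] has a
    subsequence converging to a point of [A]. If infinitely many [A_ n] had a
    point outside a sequential neighborhood [U] of [A], such points would have a
    subsequence converging to a point of [A] while staying outside [U]. *)

Local Open Scope classical_set_scope.

(** * Infinite sets of indices and increasing subsequences *)

Definition cofinal (N : set nat) : Prop :=
  forall m, exists2 n, (m <= n)%N & N n.

Lemma cofinalPn (N : set nat) : ~ cofinal N -> \forall n \near \oo, ~ N n.
Proof.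
move=> /existsNP[m /forallPNP nN].
by exists m => // n /= /nN.
Qed.

Lemma near_oo_gtP (P : set nat) :
  (\forall n \near \oo, P n) <-> exists N, forall n, (N < n)%N -> P n.
Proof.
split=> [[N _ NP]|[N NP]]; last by exists N.+1.
by exists N => n /ltnW /NP.
Qed.

(** A constant family enumerates a cofinal set; a decreasing family yields the
    diagonal of nested subsequences. *)
Lemma increasing_selection (P : nat -> set nat) :
  (forall i, cofinal (P i)) ->
  exists2 f : nat -> nat, strictly_increasing f & forall i, P i (f i).
Proof.
move=> Pcof.
have /choice[g gP] (im : nat * nat) :
    exists n, (im.2 <= n)%N /\ P im.1 n.
  by have [n ? ?] := Pcof im.1 im.2; exists n.
pose f := fix f i := if i is j.+1 then g (i, (f j).+1) else g (0%N, 0%N).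
exists f; last by case=> [|i]; [have [] := gP (0%N, 0%N)|
  have [] := gP (i.+1, (f i).+1)].
apply: homo_ltn => [y x z|i]; first exact: ltn_trans.
by have [] := gP (i.+1, (f i).+1).
Qed.

Lemma strictly_increasing_geq (f : nat -> nat) :
  strictly_increasing f -> forall k, (k <= f k)%N.
Proof.
move=> finc; elim=> // k IH; apply: (leq_ltn_trans IH).
exact: finc.
Qed.

(** * Members of the hyperspace are compact and countable *)

(** If a filter on the sequence does not cluster at the limit [x], one of its
    members misses a neighborhood of [x], so the filter lives on the finitely
    many terms outside that neighborhood. *)
Lemma convergent_sequence_compact (X : topologicalType) (C : set X) :
  convergent_sequence C -> compact C.
Proof.
move=> [u [x [ux ->]]] F PF FC.
have [clx|/existsNP[B /existsNP[O /not_implyP[FB /not_implyP[Ox BO0]]]]] :=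
  pselect (cluster F x); first by exists x; split=> //; right.
have [N _ NO] := ux _ Ox.
have cptI : compact (u @` `I_N).
  by apply: finite_compact; apply: finite_image; exact: finite_II.
have [|y [[n _ <-] cly]] := cptI F PF; last first.
  by exists (u n); split=> //; left; exists n.
apply: filterS (filterI FB FC) => y [By uy].
have nOy : ~ O y by move=> Oy; apply: BO0; exists y.
case: uy => [[n _ uny]|yx]; last first.
  by case: nOy; rewrite yx; exact: nbhs_singleton.
exists n => //=; rewrite ltnNge; apply/negP => Nn.
by apply: nOy; rewrite -uny; exact: NO.
Qed.

Lemma convergent_sequence_countable (X : topologicalType) (C : set X) :
  convergent_sequence C -> countable C.
Proof.
move=> [u [x [_ ->]]]; rewrite -bigcup2E.
apply: bigcup_countable => // -[_|[_|n _]] /=.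
- exact: (sub_countable (card_image_le _ _)).
- exact: countable1.
- exact: countable0.
Qed.

Lemma hyperspace_compact (X : topologicalType) (A : hyperspace X) :
  compact A.
Proof.
have /set_mem[_ [m [C [Ccvg ->]]]] := hyperspace_setP A.
apply/compact_near_coveringP => I F P FF cover.
have : \forall i \near F, forall k : 'I_m, C k `<=` P i.
  apply: filter_forall => k.
  have /convergent_sequence_compact/compact_near_coveringP := Ccvg k.
  by apply => // x Cx; apply: cover; exists k.
by apply: filterS => i CP x [k _ /CP].
Qed.

Lemma hyperspace_countable (X : topologicalType) (A : hyperspace X) :
  countable A.
Proof.
have /set_mem[_ [m [C [Ccvg ->]]]] := hyperspace_setP A.
apply: bigcup_countable => [|k _]; first exact: countableP.
exact: convergent_sequence_countable.
Qed.

(** * Sequences approaching a compact set *)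

(** The separation of [y] from a single point of [A] is uniform over [A] by
    compactness, with the small sets around [y] as the parameter. *)
Lemma compact_point_separation (X : topologicalType) (A : set X) (y : X) :
  hausdorff_space X -> compact A -> ~ A y ->
  exists2 V, nbhs y V & set_nbhs A (~` V).
Proof.
move=> hX /compact_near_coveringP cptA nAy.
have mono (U V : set X) :
    U `<=` V -> set_nbhs A (~` V) -> set_nbhs A (~` U).
  by move=> UV; apply: filterS; exact: subsetC.
apply/(near_powerset_filter_fromP (nbhs y) mono).
apply: (cptA _ (powerset_filter_from (nbhs y)) (fun V x => nbhs x (~` V))).
move=> x Ax; have : x != y by apply/eqP => xy; apply: nAy; rewrite -xy.
move: hX; rewrite open_hausdorff => /[apply] -[[O V]] /= [/set_mem Ox /set_mem Vy].
move=> [oO oV /eqP OV0].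
exists (O, [set W | W `<=` V]) => /=.
  split; first exact: open_nbhs_nbhs.
  exact/small_set_sub/open_nbhs_nbhs.
move=> [z W] /= [Oz WV].
apply: filterS (open_nbhs_nbhs (conj oO Oz)) => t Ot Wt.
by have : (O `&` V) t by [split=> //; exact: WV]; rewrite OV0.
Qed.

(** Suppose that no subsequence of [u] converges to a point of [A], and
    enumerate [A] as [a]. A cofinal set of indices [N] is then not contained,
    up to finitely many elements, in the preimage of some neighborhood of
    [a i], so the part of [N] that [u] sends outside this neighborhood is still
    cofinal. Treating all points [a i] in turn gives nested index sets, whose
    diagonal subsequence eventually avoids a neighborhood of each point of [A].
    By compactness finitely many of these neighborhoods cover a neighborhood of
    [A], which the subsequence then eventually avoids too: a contradiction. *)
Lemma countable_compact_cvg_subsequence (X : topologicalType) (A : set X)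
    (u : nat -> X) :
  countable A -> compact A ->
  (forall U, set_nbhs A U -> \forall n \near \oo, U (u n)) ->
  exists f a, [/\ strictly_increasing f, A a & u \o f @ \oo --> a].
Proof.
move=> /pfcard_geP[->|[a]] cptA uA.
  by have [|N _ /(_ N (leqnn N))] := uA set0.
apply: contrapT => nosub.
have Aa i : A (a i) by exact: funS.
(* If no such neighborhood of [a i] existed, enumerating [N] would give a
   subsequence converging to [a i]. *)
have /choice[O OP] (Ni : set nat * nat) :
    exists O, nbhs (a Ni.2) O /\
      (cofinal Ni.1 -> cofinal (Ni.1 `&` [set n | ~ O (u n)])).
  case: Ni => N i /=; apply: contrapT => noO.
  have cofN : cofinal N.
    apply: contrapT => ncofN; apply: noO.
    by exists setT; split; first exact: filterT.
  have [f finc Nf] := increasing_selection (fun=> N) (fun=> cofN).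
  apply: nosub; exists f, (a i); split=> // O aO.
  have /cofinalPn[m _ mP] : ~ cofinal (N `&` [set n | ~ O (u n)]).
    by move=> cofNO; apply: noO; exists O.
  exists m => // k /= mk; apply: contrapT => nO; apply: (mP (f k)) => //=.
  exact: leq_trans mk (strictly_increasing_geq _ finc k).
pose M := fix M i := if i is j.+1
  then M j `&` [set n | ~ O (M j, j) (u n)] else setT.
have Mcof i : cofinal (M i).
  by elim: i => [m|i IH]; [exists m|exact: (OP (M i, i)).2].
have Mdec i j : (i <= j)%N -> M j `<=` M i.
  by move=> /subnK <-; elim: (j - i)%N => //= k IH n [/IH].
have [f finc Mf] := increasing_selection M Mcof.
pose P m x := exists2 j, (j < m)%N & O (M j, j) x.
(* [P m] is the union of the first [m] excluded neighborhoods; it is increasing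
   in [m], so compactness lets a single [m] serve all points of [A]. *)
have [m _ /(_ m (leqnn m)) AP] : \forall m \near \oo, set_nbhs A (P m).
  move/compact_near_coveringP : cptA.
  apply: (_ : near_covering A -> _) => /(_ _ \oo (fun m x => nbhs x (P m))).
  apply=> x Ax; have [j _ ajx] := surj (f := a) Ax.
  have := (OP (M j, j)).1; rewrite /= ajx => /nbhs_interior Oj.
  exists ((O (M j, j))°, [set m | (j < m)%N]) => /=.
    by split=> //; exists j.+1.
  move=> [z m] /= [Oz jm].
  by apply: filterS Oz => t Ot; exists j.
(* A diagonal index beyond both [m] and [n] is sent into [P m], hence into some
   [O (M j, j)] with [j < m], although [M j.+1] excludes it. *)
have [n _ nP] := uA _ AP.
have [|j jm Oj] := nP (f (maxn n m)).
  exact: leq_trans (leq_maxl _ _) (strictly_increasing_geq _ finc _).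
have jmax : (j < maxn n m)%N by exact: leq_trans jm (leq_maxr _ _).
by have [_] := Mdec _ _ jmax _ (Mf (maxn n m)); apply.
Qed.

(** This is where neighborhoods can be replaced by sequential neighborhoods:
    points of [A_ n] outside [U], chosen for infinitely many [n], approach [A]
    and so have a subsequence converging into [A], contrary to the choice of
    [U]. *)
Lemma near_sub_sequential_nbhd (X : topologicalType) (A : set X)
    (A_ : nat -> set X) (U : set X) :
  countable A -> compact A ->
  (forall V, set_nbhs A V -> \forall n \near \oo, A_ n `<=` V) ->
  sequential_nbhd A U -> \forall n \near \oo, A_ n `<=` U.
Proof.
move=> ctA cptA A_A [_ UP].
have [cof|/cofinalPn] := pselect (cofinal [set n | ~ A_ n `<=` U]); last first.
  by apply: filterS => n /contrapT.
have [f finc fU] := increasing_selection (fun=> _) (fun=> cof).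
have /choice[u uP] k : exists x, A_ (f k) x /\ ~ U x.
  by have /existsNP[x /not_implyP] := fU k; exists x.
have [V AV|g [a [ginc Aa uga]]] := @countable_compact_cvg_subsequence X A u ctA cptA.
  have [N _ NV] := A_A _ AV; exists N => // k /= Nk.
  apply: NV (uP k).1 => /=; exact: leq_trans Nk (strictly_increasing_geq _ finc k).
have [N _ /(_ N (leqnn N)) /=] := UP _ _ Aa uga.
by have [] := uP (g N).
Qed.

Lemma set_nbhs_sequential_nbhd (X : topologicalType) (A U : set X) :
  set_nbhs A U -> sequential_nbhd A U.
Proof.
move=> AU; split=> [x /AU /nbhs_singleton //|u x /AU Ux ux].
exact: ux.
Qed.

Lemma nbhs_vietoris_set (X : topologicalType) (A : hyperspace X) (r : nat)
    (U : 'I_r -> set X) :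
  (forall i, open (U i)) -> A `<=` \bigcup_i U i ->
  (forall j, A `&` U j !=set0) -> nbhs A (vietoris_set U).
Proof.
move=> oU AU AUj; apply/nbhs_hyperspaceE.
by exists (vietoris_set U); [exists r, U|split=> //; split].
Qed.

(** * Convergence in the Vietoris topology *)

Section vietoris_convergence.
Context (X : topologicalType) (A : hyperspace X) (A_ : nat -> hyperspace X).

Lemma vietoris_cvg_near_sub :
  A_ @ \oo --> A -> forall U, set_nbhs A U -> \forall n \near \oo, A_ n `<=` U.
Proof.
move=> cvgA U /set_nbhsP[V [oV AV VU]].
have /set_mem[[x Ax] _] := hyperspace_setP A.
have : nbhs A (vietoris_set (fun _ : 'I_1 => V)).
  apply: nbhs_vietoris_set => // [y /AV Vy|_]; first by exists ord0.
  by exists x; split=> //; exact: AV.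
move=> /cvgA cvgV; apply: (filterS _ (cvgV : \forall n \near \oo, _ (A_ n))).
move=> n [A_V _] y /A_V[_ _]; exact: VU.
Qed.

Lemma vietoris_cvg_near_meet :
  A_ @ \oo --> A ->
  forall x O, (A : set X) x -> nbhs x O -> \forall n \near \oo, A_ n `&` O !=set0.
Proof.
move=> cvgA x O Ax; rewrite nbhsE => -[V [oV Vx] VO].
(* The whole space as a second open set removes the upper condition. *)
pose U (i : 'I_2) := if i == ord0 then V else setT.
have : nbhs A (vietoris_set U).
  apply: nbhs_vietoris_set => [i|y _|j].
  - by rewrite /U; case: ifP => // _; exact: openT.
  - by exists ord_max.
  - by exists x; split=> //; rewrite /U; case: ifP.
move=> /cvgA cvgU; apply: (filterS _ (cvgU : \forall n \near \oo, _ (A_ n))).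
move=> n [_ /(_ ord0)[y [Ay Vy]]].
by exists y; split=> //; exact: VO.
Qed.

Lemma vietoris_cvg_subsequence_limsup :
  hausdorff_space X -> A_ @ \oo --> A ->
  subsequence_limsup_eq A (fun n => A_ n : set X).
Proof.
move=> hX cvgA f finc; apply/seteqP; split=> [x Ax n _ O xO|y yA].
  have [m _ mO] := vietoris_cvg_near_meet cvgA _ _ Ax xO.
  have [|z [Az Oz]] := mO (f (maxn m n)).
    exact: leq_trans (leq_maxl _ _) (strictly_increasing_geq _ finc _).
  by exists z; split=> //; exists (maxn m n) => //; exact: leq_maxr.
apply: contrapT => nAy.
have [V yV AV] := compact_point_separation _ _ _ hX (hyperspace_compact _ A) nAy.
have [m _ mV] := vietoris_cvg_near_sub cvgA _ AV.
have [z [[k /= mk Az] Vz]] := yA m I _ yV.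
have mfk := leq_trans mk (strictly_increasing_geq _ finc k).
exact: mV mfk _ Az Vz.
Qed.

(** For the lower conditions it suffices that the limsup of every subsequence
    contains [A]: a subsequence whose terms all miss an open set has a limsup
    that misses it. *)
Lemma vietoris_cvg_of_limsup :
  subsequence_limsup_eq A (fun n => A_ n : set X) ->
  (forall U, set_nbhs A U -> \forall n \near \oo, A_ n `<=` U) ->
  A_ @ \oo --> A.
Proof.
move=> limA subA W /nbhs_hyperspaceE[_ [r [U [oU ->]]] [[AU AUj] UW]].
suff : \forall n \near \oo, vietoris_set U (A_ n) by apply: filterS => n /UW.
have AU_near : \forall n \near \oo, A_ n `<=` \bigcup_i U i.
  apply: subA; apply/set_nbhsP; exists (\bigcup_i U i); split=> //.
  exact: bigcup_open.
suff : \forall n \near \oo, forall j, A_ n `&` U j !=set0.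
  by move: AU_near; apply: filterS2 => n AnU AnUj.
apply: filter_forall => j.
have [cof|/cofinalPn] := pselect (cofinal [set n | ~ (A_ n `&` U j !=set0)]);
  last by apply: filterS => n /contrapT.
have [f finc fU] := increasing_selection (fun=> _) (fun=> cof).
have [x [Ax Ujx]] := AUj j.
move: Ax; rewrite (limA f finc) => /(_ 0%N I (U j)).
case=> [|y [[k _ Ay] Uy]]; first exact: open_nbhs_nbhs.
by case: (fU k); exists y.
Qed.

End vietoris_convergence.

Theorem theorem3p3 (X : topologicalType) (hX : hausdorff_space X)
    (A : hyperspace X) (A_ : nat -> hyperspace X) :
  let cond1 := A_ @ \oo --> A in
  let cond2 :=
    subsequence_limsup_eq A (fun n => A_ n : set X) /\
    (forall U : set X, set_nbhs A U ->
       exists N : nat, forall n : nat, (N < n)%N -> A_ n `<=` U) in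
  let cond3 :=
    subsequence_limsup_eq A (fun n => A_ n : set X) /\
    (forall U : set X, sequential_nbhd A U ->
       exists N : nat, forall n : nat, (N < n)%N -> A_ n `<=` U) in
  (cond1 <-> cond2) /\ (cond2 <-> cond3).
Proof.
move=> cond1 cond2 cond3; split; split.
- move=> cvgA; split; first exact: vietoris_cvg_subsequence_limsup.
  by move=> U /(vietoris_cvg_near_sub _ _ _ cvgA)/near_oo_gtP.
- move=> [limA subA]; apply: vietoris_cvg_of_limsup => // U /subA.
  by move=> ?; apply/near_oo_gtP.
- move=> [limA subA]; split=> // U AU; apply/near_oo_gtP.
  apply: near_sub_sequential_nbhd AU.
  + exact: hyperspace_countable.
  + exact: hyperspace_compact.
  + by move=> V /subA ?; apply/near_oo_gtP.
- move=> [limA subA]; split=> // U /set_nbhs_sequential_nbhd; exact: subA.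
Qed.
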